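(* Let $G$ be a graph and $F$ a set of nonedges of $G$ such that $G\cup F$ is a partial $3$-tree. Then $(G,F)$ has the $3$-covering map property: for every $\ell:E(G)\to\mathbb{R}_{\ge0}$, the image under the Cayley map $\phi_F$ of every connected component of $\mathcal{C}^3(G,\ell)$ equals $\Omega^3_F(G,\ell)$.
   Context: A linkage $(G,\ell)$: finite simple graph $G$ and $\ell:E(G)\to\mathbb{R}_{\ge0}$ (squared lengths). A $3$-realization is $p:V(G)\to\mathbb{R}^3$ with $\|p(x)-p(y)\|^2=\ell(xy)$ for all $xy\in E(G)$; $\mathcal{C}^3(G,\ell)\subseteq(\mathbb{R}^3)^{V(G)}$ is the set of these (with the subspace topology). For an indexed set $F=\{u_1v_1,\dots,u_mv_m\}$ of nonedges, $\phi_F(p)=(\|p(u_i)-p(v_i)\|^2)_{i}$ and $\Omega^3_F(G,\ell)=\phi_F(\mathcal{C}^3(G,\ell))$. $G\cup F$ is $G$ with the pairs of $F$ added as edges. A $3$-tree is $K_4$ or is obtained from a $3$-tree by adding a new vertex adjacent to exactly the three vertices of some triangle; a partial $3$-tree is a subgraph of a $3$-tree. *)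

(* Defs.v *)
From HB Require Import structures.
From mathcomp Require Import all_boot all_order all_algebra.
From mathcomp Require Import all_classical all_reals all_analysis.
Set Implicit Arguments. Unset Strict Implicit. Unset Printing Implicit Defensive.
Import Order.TTheory GRing.Theory Num.Theory.
Import numFieldNormedType.Exports.
Local Open Scope ring_scope.
Local Open Scope classical_set_scope.

Inductive tree3 : seq nat -> rel nat -> Prop :=
| tree3_K4 (VS : seq nat) (E : rel nat) :
    uniq VS -> size VS = 4%N ->
    (forall x y, E x y = [&& x != y, x \in VS & y \in VS]) ->
    tree3 VS E
| tree3_add (VS : seq nat) (E : rel nat) (a b c v : nat) (E' : rel nat) :
    tree3 VS E ->
    E a b -> E b c -> E a c ->
    v \notin VS ->
    (forall x y, E' x y =
       [|| E x y, (x == v) && (y \in [:: a; b; c])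
                | (y == v) && (x \in [:: a; b; c])]) ->
    tree3 (v :: VS) E'.

Definition partial_3tree (n : nat) (H : rel 'I_n) : Prop :=
  exists (VS : seq nat) (E : rel nat) (f : 'I_n -> nat),
    [/\ tree3 VS E, injective f, (forall x, f x \in VS) &
        (forall x y, H x y -> E (f x) (f y))].

Definition simple_graph (n : nat) (e : rel 'I_n) : Prop :=
  symmetric e /\ irreflexive e.

Definition graph_union (n : nat) (e : rel 'I_n) (F : seq ('I_n * 'I_n)) :
  rel 'I_n :=
  fun x y => [|| e x y, (x, y) \in F | (y, x) \in F].

Definition nonedge_set (n : nat) (e : rel 'I_n) (F : seq ('I_n * 'I_n)) :
  Prop :=
  (forall f, f \in F -> f.1 != f.2 /\ ~~ e f.1 f.2) /\
  uniq [seq [set f.1; f.2] | f <- F].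

(* A configuration p : 'M[R]_(n,3): row x is the point p(x) in R^3.
   'M[R]_(n,3) carries its standard (product / Euclidean) topology. *)
Definition sqdist (R : realType) (n : nat) (p : 'M[R]_(n, 3)) (x y : 'I_n)
  : R := \sum_(i < 3) (p x i - p y i) ^+ 2.

Definition realizations (R : realType) (n : nat) (e : rel 'I_n)
  (l : 'I_n -> 'I_n -> R) : set 'M[R]_(n, 3) :=
  [set p | forall x y, e x y -> sqdist p x y = l x y].

Definition cayley (R : realType) (n : nat) (F : seq ('I_n * 'I_n))
  (p : 'M[R]_(n, 3)) : seq R :=
  [seq sqdist p f.1 f.2 | f <- F].

Definition Omega3 (R : realType) (n : nat) (e : rel 'I_n)
  (F : seq ('I_n * 'I_n)) (l : 'I_n -> 'I_n -> R) : set (seq R) :=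
  cayley F @` realizations e l.

Definition covering_map_property3 (R : realType) (n : nat) (e : rel 'I_n)
  (F : seq ('I_n * 'I_n)) : Prop :=
  forall l : 'I_n -> 'I_n -> R,
    (forall x y, e x y -> 0 <= l x y) ->
    forall p, realizations e l p ->
      cayley F @` connected_component (realizations e l) p = Omega3 e F l.

(* Main.v *)
Require Import Defs.
From mathcomp Require Import all_boot all_order all_algebra.
From mathcomp Require Import all_classical all_reals all_analysis.
From mathcomp Require Import ring lra.
Set Implicit Arguments. Unset Strict Implicit. Unset Printing Implicit Defensive.
Import Order.TTheory GRing.Theory Num.Theory.
Import numFieldNormedType.Exports.
Local Open Scope ring_scope.
Local Open Scope classical_set_scope.

(* Complete G to the whole 3-tree T by treating every other edge of T as a
   member of F.  Let p and q realize (G, l).  Suppose first that no triangle of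
   vertices is collinear in p or in q, and interpolate the squared T-lengths
   linearly from p to q; the lengths on G do not change.  The Gram matrix of a
   triangle is then a convex combination of positive definite matrices, so the
   triangle never degenerates, and the interpolated lengths are realized
   continuously, one vertex of the 3-tree at a time, starting from p: the height
   of the new vertex over its base triangle is the square root of a nonnegative
   continuous function, and its side is the one it has in p.
   In general, move p and q slightly along the moment curve to reach general
   position.  The resulting paths lie in a common compact set and start at
   points tending to p, so their upper limit is connected; it contains p, lies
   in the realization space of (G, l), and contains a configuration with the
   T-lengths of q. *)

(** * Coordinates in dimension three *)

Section Points.
Variable R : realType.
Implicit Types u v a b c : 'I_3 -> R.

Definition dot u v : R := \sum_(i < 3) u i * v i.
Definition sqd u v : R := \sum_(i < 3) (u i - v i) ^+ 2.
(* Indices are taken in Z/3. *)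
Definition cross u v : 'I_3 -> R := fun i =>
  u (i + 1) * v (i + 2) - u (i + 2) * v (i + 1).

Lemma sum3 (f : 'I_3 -> R) : \sum_(i < 3) f i = f 0 + f 1 + f 2.
Proof.
rewrite !big_ord_recl big_ord0 addr0 addrA; congr (f _ + f _ + f _); exact: val_inj.
Qed.

Lemma ord3P (P : 'I_3 -> Prop) : P 0 -> P 1 -> P 2 -> forall i, P i.
Proof.
move=> P0 P1 P2 [[|[|[|//]]] Hi].
- by rewrite (_ : Ordinal Hi = 0) //; apply: val_inj.
- by rewrite (_ : Ordinal Hi = 1) //; apply: val_inj.
- by rewrite (_ : Ordinal Hi = 2) //; apply: val_inj.
Qed.

Lemma cross_coords u v :
  (cross u v 0 = u 1 * v 2 - u 2 * v 1) *
  (cross u v 1 = u 2 * v 0 - u 0 * v 2) *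
  (cross u v 2 = u 0 * v 1 - u 1 * v 0).
Proof.
have e11 : 1 + 1 = 2 :> 'I_3 by apply: val_inj.
have e12 : 1 + 2 = 0 :> 'I_3 by apply: val_inj.
have e21 : 2 + 1 = 0 :> 'I_3 by apply: val_inj.
have e22 : 2 + 2 = 1 :> 'I_3 by apply: val_inj.
by rewrite /cross !add0r e11 e12 e21 e22.
Qed.

(** Gram determinant of two vectors; its positivity expresses their linear independence. *)
Definition gdet u v : R := dot u u * dot v v - dot u v ^+ 2.

Lemma lagrange u v : dot (cross u v) (cross u v) = gdet u v.
Proof. by rewrite /gdet /dot !sum3 !cross_coords; ring. Qed.

(** Expansion of [u] in the frame [v], [w], [cross v w], multiplied by [gdet v w] to clear
    denominators. *)
Lemma cramer u v w i :
  gdet v w * u i =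
    (dot u v * dot w w - dot u w * dot v w) * v i
    + (dot u w * dot v v - dot u v * dot v w) * w i
    + dot u (cross v w) * cross v w i.
Proof.
elim/ord3P: i; rewrite /gdet /dot !sum3 !cross_coords; ring.
Qed.

(** The left side is the 3x3 Gram determinant expanded along its first row, the right side the
    squared triple product. *)
Lemma gram3 u v w :
  dot u u * gdet v w - dot u v * (dot u v * dot w w - dot u w * dot v w)
  - dot u w * (dot u w * dot v v - dot u v * dot v w)
  = dot u (cross v w) ^+ 2.
Proof. rewrite /gdet /dot !sum3 !cross_coords; ring. Qed.

Lemma dot_ge0 u : 0 <= dot u u.
Proof. by rewrite /dot sumr_ge0 // => i _; rewrite -expr2 sqr_ge0. Qed.

Lemma sqd_dot u v : sqd u v = dot (u \- v) (u \- v).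
Proof. by rewrite /sqd /dot; apply: eq_bigr => i _; rewrite expr2. Qed.

Lemma sqdC u v : sqd u v = sqd v u.
Proof. by rewrite /sqd; apply: eq_bigr => i _; rewrite -sqrrN opprB. Qed.

Definition mix (w x y : R) : R := (1 - w) * x + w * y.

Lemma dot_polarization a b c : dot (b \- a) (c \- a) = (sqd b a + sqd c a - sqd b c) / 2.
Proof. by rewrite /sqd /dot !sum3 /=; field. Qed.

(** Positive definite 2x2 matrices form a convex cone: the determinant of the mixture is quadratic
    in the weights, with the two determinants on the squares and the mixed discriminant on the cross
    term. *)
Lemma mix_gdet_gt0 w u v u' v' : 0 <= w <= 1 -> 0 < gdet u v -> 0 < gdet u' v' ->
  0 < mix w (dot u u) (dot u' u') * mix w (dot v v) (dot v' v')
      - mix w (dot u v) (dot u' v') ^+ 2.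
Proof.
rewrite /gdet /mix.
move: (dot_ge0 u) (dot_ge0 v) (dot_ge0 u') (dot_ge0 v').
move: (dot u u) (dot v v) (dot u v) (dot u' u') (dot v' v') (dot u' v').
move=> p q r p' q' r' p0 q0 p0' q0' /andP[w0 w1] h h'.
have pp : 0 < p.
  rewrite lt_neqAle p0 andbT; apply/eqP => p00; move: h; rewrite -p00 mul0r sub0r.
  by rewrite oppr_gt0 ltNge sqr_ge0.
have pp' : 0 < p'.
  rewrite lt_neqAle p0' andbT; apply/eqP => p00; move: h'; rewrite -p00 mul0r sub0r.
  by rewrite oppr_gt0 ltNge sqr_ge0.
(* The mixed discriminant times [p * p'] is [p^2 (p'q' - r'^2) + p'^2 (pq - r^2) + (pr' -
   p'r)^2]. *)
have K : 0 <= p * q' + p' * q - 2 * r * r'.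
  rewrite -(pmulr_rge0 _ (mulr_gt0 pp pp')).
  have := sqr_ge0 (p * r' - p' * r).
  have := mulr_ge0 (sqr_ge0 p) (ltW h').
  have := mulr_ge0 (sqr_ge0 p') (ltW h).
  lra.
rewrite (_ : _ - _ = (1 - w) ^+ 2 * (p * q - r ^+ 2) + w ^+ 2 * (p' * q' - r' ^+ 2)
   + w * (1 - w) * (p * q' + p' * q - 2 * r * r')); last by ring.
have w1' : 0 <= 1 - w by rewrite subr_ge0.
have := mulr_ge0 (mulr_ge0 w0 w1') K.
have := mulr_ge0 (sqr_ge0 (1 - w)) (ltW h); have := mulr_ge0 (sqr_ge0 w) (ltW h').
have [->|wn0] := eqVneq w 0.
  by rewrite subr0 !expr1n expr0n /= !mul0r !addr0 mul1r.
move=> _ A B; apply: ltr_wpDr => //; apply: ltr_wpDl => //.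
by apply: mulr_gt0 => //; rewrite exprn_even_gt0.
Qed.

Lemma frame_dot u v al be ga (z := fun i => al * u i + be * v i + ga * cross u v i) :
  [/\ dot z u = al * dot u u + be * dot u v,
      dot z v = al * dot u v + be * dot v v &
      dot z z = al * dot z u + be * dot z v + ga ^+ 2 * gdet u v].
Proof.
by split; rewrite /z /gdet /dot !sum3 !cross_coords; ring.
Qed.

(** For fixed [al] and [be] the right side is linear in the Gram entries, hence compatible with
    [mix]. *)
Lemma residual_dot u v z al be (y := fun i => z i - al * u i - be * v i) :
  dot y y = dot z z - 2 * al * dot z u - 2 * be * dot z v
    + al ^+ 2 * dot u u + 2 * al * be * dot u v + be ^+ 2 * dot v v.
Proof. by rewrite /y /dot !sum3; ring. Qed.

Lemma mix0 x y : mix 0 x y = x.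
Proof. by rewrite /mix subr0 mul1r mul0r addr0. Qed.

Lemma mix_ge0 w x y : 0 <= w <= 1 -> 0 <= x -> 0 <= y -> 0 <= mix w x y.
Proof.
by move=> /andP[w0 w1] x0 y0; rewrite addr_ge0 // mulr_ge0 // subr_ge0.
Qed.

Lemma mix_le w x y : 0 <= w <= 1 -> 0 <= x -> 0 <= y -> mix w x y <= x + y.
Proof.
move=> /andP[w0 w1] x0 y0; rewrite lerD // ler_piMl //.
by rewrite gerBl.
Qed.

End Points.

(** * Realizing interpolated squared distances continuously *)

Section Paths.
Variables (R : realType) (T : topologicalType) (w : T -> R) (t0 : T).
Hypotheses (w_cont : continuous w) (w01 : forall t, 0 <= w t <= 1) (w_t0 : w t0 = 0).
Implicit Types (f g : T -> R) (a b c x y : T -> 'I_3 -> R).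

Lemma contD f g : continuous f -> continuous g -> continuous (fun t => f t + g t).
Proof. by move=> cf cg t; apply: cvgD; [exact: cf|exact: cg]. Qed.
Lemma contB f g : continuous f -> continuous g -> continuous (fun t => f t - g t).
Proof. by move=> cf cg t; apply: cvgB; [exact: cf|exact: cg]. Qed.
Lemma contM f g : continuous f -> continuous g -> continuous (fun t => f t * g t).
Proof. by move=> cf cg t; apply: cvgM; [exact: cf|exact: cg]. Qed.
Lemma contX f : continuous f -> continuous (fun t => f t ^+ 2).
Proof. by move=> cf; exact: contM. Qed.
Lemma contC (k : R) : continuous (fun _ : T => k).
Proof. by move=> t; apply: cvg_cst. Qed.
Lemma contV f : (forall t, f t != 0) -> continuous f -> continuous (fun t => (f t)^-1).
Proof. by move=> f0 cf t; apply: cvgV; [exact: f0|exact: cf]. Qed.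
Lemma contS f : continuous f -> continuous (fun t => Num.sqrt (f t)).
Proof.
move=> cf t; apply: (@continuous_comp _ _ _ f (@Num.sqrt R)); first exact: cf.
exact: sqrt_continuous.
Qed.
Lemma cont_mix (k l : R) : continuous (fun t => mix (w t) k l).
Proof.
by apply: contD; apply: contM => //; try exact: contC; apply: contB => //; exact: contC.
Qed.

Definition follows x y (p p' q q' : 'I_3 -> R) :=
  forall t, sqd (x t) (y t) = mix (w t) (sqd p p') (sqd q q').

Lemma follows_dot a b c pa pb pc qa qb qc t :
  follows b a pb pa qb qa -> follows c a pc pa qc qa -> follows b c pb pc qb qc ->
  dot (b t \- a t) (c t \- a t) =
  mix (w t) (dot (pb \- pa) (pc \- pa)) (dot (qb \- qa) (qc \- qa)).
Proof.
by move=> h1 h2 h3; rewrite !dot_polarization h1 h2 h3 /mix; field.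
Qed.

Lemma follows_norm a b pa pb qa qb t :
  follows b a pb pa qb qa ->
  dot (b t \- a t) (b t \- a t) =
  mix (w t) (dot (pb \- pa) (pb \- pa)) (dot (qb \- qa) (qb \- qa)).
Proof. by move=> h; rewrite -!sqd_dot h. Qed.

Lemma attach_vertex a b c (pa pb pc pv qa qb qc qv : 'I_3 -> R) :
  (forall i, continuous (a ^~ i)) -> (forall i, continuous (b ^~ i)) ->
  (forall i, continuous (c ^~ i)) ->
  a t0 =1 pa -> b t0 =1 pb -> c t0 =1 pc ->
  follows b a pb pa qb qa -> follows c a pc pa qc qa -> follows b c pb pc qb qc ->
  0 < gdet (pb \- pa) (pc \- pa) -> 0 < gdet (qb \- qa) (qc \- qa) ->
  exists v : T -> 'I_3 -> R, [/\ forall i, continuous (v ^~ i), v t0 =1 pv,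
    follows v a pv pa qv qa, follows v b pv pb qv qb & follows v c pv pc qv qc].
Proof.
move=> ca cb cc a0 b0 c0 fba fca fbc gp gq.
pose pu := pb \- pa; pose pw := pc \- pa; pose pz := pv \- pa.
pose qu := qb \- qa; pose qw := qc \- qa; pose qz := qv \- qa.
pose g11 t := mix (w t) (dot pu pu) (dot qu qu).
pose g12 t := mix (w t) (dot pu pw) (dot qu qw).
pose g22 t := mix (w t) (dot pw pw) (dot qw qw).
pose r0 t := mix (w t) (dot pz pz) (dot qz qz).
pose r1 t := mix (w t) (dot pz pu) (dot qz qu).
pose r2 t := mix (w t) (dot pz pw) (dot qz qw).
pose D t := g11 t * g22 t - g12 t ^+ 2.
have D0 t : 0 < D t by exact: mix_gdet_gt0.
have Dn0 t : D t != 0 by rewrite gt_eqF.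
(* Coordinates of the foot of the perpendicular from the new vertex, in the basis of the two edges
   at [a]: Cramer's rule for the normal equations [e1] and [e2]. *)
pose al t := (r1 t * g22 t - r2 t * g12 t) / D t.
pose be t := (r2 t * g11 t - r1 t * g12 t) / D t.
have e1 t : al t * g11 t + be t * g12 t = r1 t.
  by have := Dn0 t; rewrite /al /be /D => dn0; field.
have e2 t : al t * g12 t + be t * g22 t = r2 t.
  by have := Dn0 t; rewrite /al /be /D => dn0; field.
(* the squared height of the new vertex over the plane of the triangle *)
pose h t := r0 t - al t * r1 t - be t * r2 t.
have h0 t : 0 <= h t.
  (* With the coefficients frozen at time [t], the residuals taken in the two given configurations
     have nonnegative squared norms. By linearity their mixture is the residual form in the
     interpolated Gram entries, which equals [h t] at the foot. *)
  have := mix_ge0 (w01 t) (dot_ge0 (fun i => pz i - al t * pu i - be t * pw i))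
    (dot_ge0 (fun i => qz i - al t * qu i - be t * qw i)).
  rewrite !residual_dot; congr (_ <= _).
  rewrite /h -e1 -e2; transitivity (r0 t - 2 * al t * r1 t - 2 * be t * r2 t
    + al t ^+ 2 * g11 t + 2 * al t * be t * g12 t + be t ^+ 2 * g22 t).
    by rewrite /r0 /r1 /r2 /g11 /g12 /g22 /mix; ring.
  by rewrite -e1 -e2; ring.
(* the side on which pv lies of the plane through pa, pb, pc *)
pose s : R := if 0 <= dot pz (cross pu pw) then 1 else -1.
have s2 : s ^+ 2 = 1 by rewrite /s; case: ifP; rewrite ?sqrrN expr1n.
(* The cross product of the moving edges has squared length [D t], so its coefficient is the height
   divided by the root of [D t]. *)
pose ga t := s * Num.sqrt (h t / D t).
have ga2 t : ga t ^+ 2 * D t = h t.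
  rewrite exprMn s2 mul1r sqr_sqrtr ?divfK //.
  by rewrite divr_ge0 // ltW.
pose u t := b t \- a t; pose u' t := c t \- a t.
have uu t : dot (u t) (u t) = g11 t by exact: follows_norm.
have ww t : dot (u' t) (u' t) = g22 t by exact: follows_norm.
have uw t : dot (u t) (u' t) = g12 t by exact: follows_dot.
pose z t i := al t * u t i + be t * u' t i + ga t * cross (u t) (u' t) i.
have zu t : dot (z t) (u t) = r1 t.
  by have [-> _ _] := frame_dot (u t) (u' t) (al t) (be t) (ga t); rewrite uu uw.
have zw t : dot (z t) (u' t) = r2 t.
  by have [_ -> _] := frame_dot (u t) (u' t) (al t) (be t) (ga t); rewrite ww uw.
have zz t : dot (z t) (z t) = r0 t.
  have [_ _ ->] := frame_dot (u t) (u' t) (al t) (be t) (ga t).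
  by rewrite zu zw /gdet uu ww uw ga2 /h; ring.
pose v t i := a t i + z t i.
have va t : sqd (v t) (a t) = r0 t.
  by rewrite -zz /sqd /dot; apply: eq_bigr => i _; rewrite /v -expr2; ring.
exists v; split.
- move=> i.
  have cw : continuous w by [].
  have cg11 : continuous g11 by exact: cont_mix.
  have cg12 : continuous g12 by exact: cont_mix.
  have cg22 : continuous g22 by exact: cont_mix.
  have cr0 : continuous r0 by exact: cont_mix.
  have cr1 : continuous r1 by exact: cont_mix.
  have cr2 : continuous r2 by exact: cont_mix.
  have cD : continuous D by apply: contB; [exact: contM|exact: contX].
  have cDV : continuous (fun t => (D t)^-1) by exact: contV.
  have cal : continuous al by apply: contM => //; apply: contB; exact: contM.
  have cbe : continuous be by apply: contM => //; apply: contB; exact: contM.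
  have ch : continuous h by apply: contB; [apply: contB => //|]; exact: contM.
  have cga : continuous ga.
    by apply: contM; [exact: contC|apply: contS; exact: contM].
  have cu j : continuous (fun t => u t j) by exact: contB.
  have cu' j : continuous (fun t => u' t j) by exact: contB.
  apply: contD => //; apply: contD; first by apply: contD; exact: contM.
  by apply: contM => //; apply: contB; exact: contM.
- move=> i; rewrite /v.
  have zt0 : z t0 i = pz i.
    have ut0 : u t0 = pu by apply/funext => j; rewrite /u /= a0 b0.
    have ut0' : u' t0 = pw by apply/funext => j; rewrite /u' /= a0 c0.
    have Dp : D t0 = gdet pu pw by rewrite /D /g11 /g12 /g22 w_t0 !mix0.
    (* By [gram3] the initial squared height is the squared triple product over [D t0]. Its root
       produces an absolute value, [s] restores the sign, and [cramer] then identifies [z t0] with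
       [pz]. *)
    have hp : h t0 / D t0 = (dot pz (cross pu pw) / D t0) ^+ 2.
      rewrite expr_div_n -gram3 -Dp /h /al /be /r0 /r1 /r2 /g11 /g12 /g22 w_t0 !mix0.
      by have := Dn0 t0; set d := D t0 => dn0; field.
    apply: (mulfI (Dn0 t0)); rewrite {2}Dp cramer /z ut0 ut0' /ga hp sqrtr_sqr.
    rewrite normrM normfV (gtr0_norm (D0 t0)).
    have ss : s * `|dot pz (cross pu pw)| = dot pz (cross pu pw).
      rewrite /s; case: (lerP 0) => [?|?]; first by rewrite mul1r ger0_norm.
      by rewrite ltr0_norm // mulrNN mul1r.
    rewrite mulrA ss /al /be /r1 /r2 /g11 /g12 /g22 w_t0 !mix0.
    by have := Dn0 t0; set d := D t0 => dn0; field.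
  by rewrite zt0 a0 /pz /=; ring.
- by move=> t; rewrite va /r0 !sqd_dot.
- move=> t; have -> : sqd (v t) (b t) = dot (z t) (z t) - 2 * dot (z t) (u t) + dot (u t) (u t).
    by rewrite /sqd /dot !sum3 /v /u /=; ring.
  rewrite zz zu uu /r0 /r1 /g11 /mix /pz /pu /qz /qu /sqd /dot !sum3 /=; ring.
- move=> t; have -> : sqd (v t) (c t) = dot (z t) (z t) - 2 * dot (z t) (u' t) + dot (u' t) (u' t).
    by rewrite /sqd /dot !sum3 /v /u' /=; ring.
  rewrite zz zw ww /r0 /r2 /g22 /mix /pz /pw /qz /qw /sqd /dot !sum3 /=; ring.
Qed.

End Paths.

(** * Realizations of 3-trees *)

Lemma tree3_edge VS E x y : tree3 VS E -> E x y -> [/\ x != y, x \in VS & y \in VS].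
Proof.
move=> tE; elim: tE x y => {VS E} [VS E _ _ HE x y|VS E a b c v E' _ IH ab bc ac vV HE x y].
  by rewrite HE => /and3P[].
have [_ aV bV] := IH _ _ ab; have [_ _ cV] := IH _ _ bc.
have abcV z : z \in [:: a; b; c] -> z \in VS.
  by rewrite !inE => /or3P[] /eqP ->.
have abcv z : z \in [:: a; b; c] -> z != v.
  by move=> /abcV zV; apply: contraNneq vV => <-.
rewrite HE => /or3P[/IH[-> xV yV]|/andP[/eqP -> yabc]|/andP[/eqP -> xabc]].
- by rewrite !inE xV yV !orbT.
- by rewrite eq_sym (abcv _ yabc) !inE eqxx (abcV _ yabc) orbT.
- by rewrite (abcv _ xabc) !inE eqxx (abcV _ xabc) orbT.
Qed.

Definition generic (R : realType) (VS : seq nat) (P : nat -> 'I_3 -> R) :=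
  forall x y z, x \in VS -> y \in VS -> z \in VS -> uniq [:: x; y; z] ->
  0 < gdet (P y \- P x) (P z \- P x).

Section TreePath.
Variables (R : realType) (T : topologicalType) (w : T -> R) (t0 : T).
Hypotheses (w_cont : continuous w) (w01 : forall t, 0 <= w t <= 1) (w_t0 : w t0 = 0).

Definition lifts (E : rel nat) (P Q : nat -> 'I_3 -> R) (X : nat -> T -> 'I_3 -> R) :=
  [/\ forall v i, continuous (X v ^~ i), forall v, X v t0 =1 P v &
      forall x y, E x y -> follows w (X x) (X y) (P x) (P y) (Q x) (Q y)].

Lemma followsC x y (p p' q q' : 'I_3 -> R) :
  follows w x y p p' q q' -> follows w y x p' p q' q.
Proof. by move=> h t; rewrite sqdC h (sqdC p) (sqdC q). Qed.

(** An explicit motion: [pa] is fixed, the second vertex slides on its ray from [pa], and the third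
    stays in the half-plane bounded by that line and containing [pc]. *)
Lemma base_triangle (pa pb pc qa qb qc : 'I_3 -> R) :
  0 < gdet (pb \- pa) (pc \- pa) -> 0 < gdet (qb \- qa) (qc \- qa) ->
  exists b c : T -> 'I_3 -> R,
    [/\ forall i, continuous (b ^~ i) /\ continuous (c ^~ i),
        b t0 =1 pb, c t0 =1 pc,
        follows w b (fun=> pa) pb pa qb qa /\
        follows w c (fun=> pa) pc pa qc qa &
        follows w b c pb pc qb qc].
Proof.
move=> gp gq.
pose pu := pb \- pa; pose pw := pc \- pa; pose qu := qb \- qa; pose qw := qc \- qa.
pose g11 t := mix (w t) (dot pu pu) (dot qu qu).
pose g12 t := mix (w t) (dot pu pw) (dot qu qw).
pose g22 t := mix (w t) (dot pw pw) (dot qw qw).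
pose D t := g11 t * g22 t - g12 t ^+ 2.
have D0 t : 0 < D t by exact: mix_gdet_gt0.
have G0 t : 0 < g11 t.
  rewrite lt_neqAle mix_ge0 ?dot_ge0 // andbT; apply/eqP => g0; move: (D0 t).
  by rewrite /D -g0 mul0r sub0r oppr_gt0 ltNge sqr_ge0.
have Gn0 t : g11 t != 0 by rewrite gt_eqF.
have g11_0 : g11 t0 = dot pu pu by rewrite /g11 w_t0 mix0.
have g12_0 : g12 t0 = dot pu pw by rewrite /g12 w_t0 mix0.
have g22_0 : g22 t0 = dot pw pw by rewrite /g22 w_t0 mix0.
(* Gram-Schmidt: the part of [pw] orthogonal to [pu], that is, the altitude of the initial
   triangle. *)
pose n i := pw i - g12 t0 / g11 t0 * pu i.
have nu : dot n pu = 0.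
  have := Gn0 t0; rewrite /n g12_0 g11_0 /dot !sum3 => h; field; exact: h.
have nn : dot n n = D t0 / g11 t0.
  have := Gn0 t0; rewrite /D /n g12_0 g22_0 g11_0 /dot !sum3 => h; field; exact: h.
have Dn0 : D t0 != 0 by rewrite gt_eqF.
(* Ratios of current to initial length, for the edge and for the altitude over it; both are 1 at
   [t0]. *)
pose la t := Num.sqrt (g11 t / g11 t0).
pose mu t := Num.sqrt (D t / g11 t / (D t0 / g11 t0)).
have la2 t : la t ^+ 2 * g11 t0 = g11 t.
  by rewrite sqr_sqrtr ?divfK // divr_ge0 // ltW.
have mu2 t : mu t ^+ 2 * (D t0 / g11 t0) = D t / g11 t.
  rewrite sqr_sqrtr ?divfK // ?mulf_neq0 ?invr_eq0 //.
  by rewrite !mulr_ge0 // ?invr_ge0 ?mulr_ge0 ?invr_ge0 ?ltW.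
pose u t i := la t * pu i.
pose z t i := g12 t / g11 t * u t i + mu t * n i.
have uu t : dot (u t) (u t) = g11 t.
  by rewrite -(la2 t) g11_0 /dot !sum3 /u; ring.
have zu t : dot (z t) (u t) = g12 t.
  transitivity (g12 t / g11 t * dot (u t) (u t) + mu t * la t * dot n pu).
    by rewrite /dot !sum3 /z /u; ring.
  by rewrite nu uu mulr0 addr0 divfK.
have zz t : dot (z t) (z t) = g22 t.
  transitivity ((g12 t / g11 t) ^+ 2 * dot (u t) (u t)
      + 2 * (g12 t / g11 t) * mu t * la t * dot n pu + mu t ^+ 2 * dot n n).
    by rewrite /dot !sum3 /z /u; ring.
  by rewrite nu uu nn mu2 /D; have := Gn0 t => h; field.
exists (fun t i => pa i + u t i), (fun t i => pa i + z t i); split.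
- move=> i.
  have cg11 : continuous g11 by exact: cont_mix.
  have cg12 : continuous g12 by exact: cont_mix.
  have cg22 : continuous g22 by exact: cont_mix.
  have cV : continuous (fun t => (g11 t)^-1) by exact: contV.
  have cD : continuous D by apply: contB; [exact: contM|exact: contX].
  have cla : continuous la by apply: contS; apply: contM => //; exact: contC.
  have cmu : continuous mu.
    by apply: contS; apply: contM; [exact: contM|exact: contC].
  have cu : continuous (u ^~ i) by apply: contM => //; exact: contC.
  split; apply: contD => //; try exact: contC.
  by apply: contD; apply: contM => //; [exact: contM|exact: contC].
- move=> i; have -> : u t0 i = pu i by rewrite /u /la divff // sqrtr1 mul1r.
  by rewrite /pu /=; ring.
- move=> i; rewrite /z /u /la /mu !divff ?sqrtr1 ?mul1r ?mulf_neq0 ?invr_eq0 //.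
  by rewrite /n /pw /=; ring.
- split=> t.
    transitivity (dot (u t) (u t)); first by rewrite /sqd /dot !sum3; ring.
    by rewrite uu /g11 -!sqd_dot.
  transitivity (dot (z t) (z t)); first by rewrite /sqd /dot !sum3; ring.
  by rewrite zz /g22 -!sqd_dot.
- move=> t.
  transitivity (dot (u t) (u t) - 2 * dot (z t) (u t) + dot (z t) (z t)).
    by rewrite /sqd /dot !sum3; ring.
  rewrite uu zu zz /g11 /g12 /g22 /mix /pu /pw /qu /qw /sqd /dot !sum3 /=; ring.
Qed.

(** Induction along the construction of the 3-tree, from a base triangle with a fourth vertex
    attached. The motionless vertex [r] is recorded because it later confines all paths to one
    compact set. *)
Lemma tree3_lift VS E P Q : tree3 VS E -> generic VS P -> generic VS Q ->
  exists2 X, lifts E P Q X & exists2 r, r \in VS & forall t, X r t = P r.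
Proof.
move=> tE; elim: tE => {VS E} [VS E uV sV HE gP gQ|VS E a b c v E' tE IH ab bc ac vV HE gP gQ].
  have [a [b [c [d VSE]]]] : exists a b c d, VS = [:: a; b; c; d].
    by case: VS sV {uV HE gP gQ} => [|a [|b [|c [|d []]]]] //= _; exists a, b, c, d.
  have uabc : uniq [:: a; b; c].
    by move: uV; rewrite VSE (cat_uniq [:: a; b; c] [:: d]) => /andP[].
  have [aV bV cV] : [/\ a \in VS, b \in VS & c \in VS].
    by rewrite VSE !inE !eqxx !orbT.
  have gp := gP _ _ _ aV bV cV uabc; have gq := gQ _ _ _ aV bV cV uabc.
  have [xb [xc [cbc b0 c0 [fba fca] fbc]]] := base_triangle gp gq.
  have [xd [cd d0 fda fdb fdc]] := attach_vertex w_cont w01 w_t0 (P d) (Q d)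
    (fun i => @contC R T (P a i)) (fun i => (cbc i).1) (fun i => (cbc i).2)
    (fun i => erefl) b0 c0 fba fca fbc gp gq.
  (* Numbers that are not vertices of the tree stay where [P] puts them. *)
  pose X x := if x == a then fun=> P a else if x == b then xb else
    if x == c then xc else if x == d then xd else fun=> P x.
  have Xa : X a = fun=> P a by rewrite /X eqxx.
  move: uV; rewrite VSE /= !inE !negb_or => /and4P[/and3P[anb anc and] /andP[bnc bnd] cnd _].
  have Xb : X b = xb by rewrite /X eqxx (eq_sym b a) (negbTE anb).
  have Xc : X c = xc.
    by rewrite /X eqxx (eq_sym c a) (eq_sym c b) (negbTE anc) (negbTE bnc).
  have Xd : X d = xd.
    by rewrite /X eqxx !(eq_sym d) (negbTE and) (negbTE bnd) (negbTE cnd).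
  exists X; last by exists a => [|t]; rewrite ?Xa // inE eqxx.
  split.
  - move=> x i; rewrite /X; case: eqP => _; first exact: contC.
    case: eqP => _; first exact: (cbc i).1.
    case: eqP => _; first exact: (cbc i).2.
    by case: eqP => _ //; exact: contC.
  - move=> x i; rewrite /X; case: eqP => [->//|_]; case: eqP => [->|_]; first exact: b0.
    by case: eqP => [->|_]; [exact: c0|case: eqP => [->|//]; exact: d0].
  - move=> x y; rewrite HE VSE !inE => /and3P[xy /or4P[] /eqP xE /or4P[] /eqP yE];
      move: xy; rewrite xE yE ?eqxx // => _; rewrite ?Xa ?Xb ?Xc ?Xd //; exact: followsC.
have sub (Z : nat -> 'I_3 -> R) : generic (v :: VS) Z -> generic VS Z.
  by move=> gZ x y z xV yV zV; apply: gZ; rewrite inE ?xV ?yV ?zV orbT.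
have [X [cX X0 fX] [r rV Xr]] := IH (sub _ gP) (sub _ gQ).
have [nab aV bV] := tree3_edge tE ab; have [nbc _ cV] := tree3_edge tE bc.
have [nac _ _] := tree3_edge tE ac.
have uabc : uniq [:: a; b; c] by rewrite /= !inE negb_or nab nac nbc.
have gp := sub _ gP _ _ _ aV bV cV uabc; have gq := sub _ gQ _ _ _ aV bV cV uabc.
have [xv [cv v0 fva fvb fvc]] := attach_vertex w_cont w01 w_t0 (P v) (Q v)
  (cX a) (cX b) (cX c) (X0 a) (X0 b) (X0 c) (followsC (fX _ _ ab)) (followsC (fX _ _ ac))
  (fX _ _ bc) gp gq.
pose Y x := if x == v then xv else X x.
have Yv : Y v = xv by rewrite /Y eqxx.
have YX x : x \in VS -> Y x = X x.
  by move=> xV; rewrite /Y; case: eqP => // xv'; rewrite -xv' xV in vV.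
have fY x : x \in [:: a; b; c] -> follows w (Y v) (Y x) (P v) (P x) (Q v) (Q x).
  by rewrite Yv !inE => /or3P[] /eqP ->; rewrite YX.
exists Y; last by exists r; [rewrite inE rV orbT|move=> t; rewrite YX].
split.
- by move=> x i; rewrite /Y; case: eqP.
- by move=> x i; rewrite /Y; case: eqP => [->|_]; [exact: v0|exact: X0].
- move=> x y; rewrite HE => /or3P[xy|/andP[/eqP -> /fY]|/andP[/eqP -> /fY]] //.
    have [_ xV yV] := tree3_edge tE xy.
    by rewrite !YX //; exact: fX.
  exact: followsC.
Qed.

End TreePath.

(** A 3-tree is connected, so a chain of at most [size VS] edges joins two vertices; the induction
    spends one more [B] on the edge from the new vertex to [a]. Later [g] is one coordinate at one
    time. *)
Lemma tree3_diam (R : realType) VS E (B : R) (g : nat -> R) :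
  tree3 VS E -> (forall x y, E x y -> `|g x - g y| <= B) ->
  forall x y, x \in VS -> y \in VS -> `|g x - g y| <= (size VS)%:R * B.
Proof.
move=> tE; elim: tE => {VS E} [VS E uV sV HE gB|VS E a b c v E' tE IH ab bc ac vV HE gB].
  have B0 : 0 <= B.
    case: VS uV sV HE => [|a [|b VS]] //= /andP[+ _] _ HE.
    rewrite inE negb_or => /andP[anb _]; apply: le_trans (gB a b _) => //.
    by rewrite HE anb !inE !eqxx orbT.
  move=> x y xV yV; rewrite sV.
  have [->|nxy] := eqVneq x y; first by rewrite subrr normr0 mulr_ge0.
  have : `|g x - g y| <= B by apply: gB; rewrite HE nxy xV yV.
  by move=> h; apply: (le_trans h); rewrite ler_peMl // ler1n.
have EE' x y : E x y -> E' x y by rewrite HE => ->.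
have {}IH := IH (fun x y xy => gB x y (EE' x y xy)).
have B0 : 0 <= B by apply: le_trans (gB _ _ (EE' _ _ ab)).
have [_ aV _] := tree3_edge tE ab.
have vB : `|g v - g a| <= B by apply: gB; rewrite HE eqxx !inE eqxx /= orbT.
have vx x : x \in VS -> `|g v - g x| <= (size (v :: VS))%:R * B.
  move=> xV; rewrite /= mulrSr mulrDl mul1r [leRHS]addrC.
  rewrite -(subrKA (g a)); apply: le_trans (ler_normD _ _) _.
  by rewrite lerD // IH.
move=> x y; rewrite !inE => /orP[/eqP ->|xV] /orP[/eqP ->|yV].
- by rewrite subrr normr0 mulr_ge0.
- exact: vx.
- by rewrite distrC vx.
- by apply: le_trans (IH _ _ xV yV) _; rewrite ler_wpM2r // ler_nat /=.
Qed.

(** * Upper limits of connected sets *)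

Lemma open_separated (T : topologicalType) (U V : set T) :
  open U -> open V -> U `&` V = set0 -> separated U V.
Proof.
move=> oU oV UV0; split; rewrite -subset0 => x [].
  move=> clx Vx; have := clx V (open_nbhs_nbhs (conj oV Vx)).
  by rewrite UV0 => -[].
move=> Ux clx; have := clx U (open_nbhs_nbhs (conj oU Ux)).
by rewrite setIC UV0 => -[].
Qed.

(** Kuratowski's upper limit: the points all of whose neighbourhoods meet [C k] for arbitrarily
    large [k]. *)
Definition limsup_sets (T : topologicalType) (C : nat -> set T) : set T :=
  \bigcap_N closure (\bigcup_(k in [set k | (N <= k)%N]) C k).

Lemma limsup_setsP (T : topologicalType) (C : nat -> set T) (x : T)
    (N : nat) (A : set T) :
  limsup_sets C x -> nbhs x A -> exists k y, [/\ (N <= k)%N, C k y & A y].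
Proof. by move=> /(_ N I) cl /cl [y [[k /= Nk Cky] Ay]]; exists k, y. Qed.

Lemma cluster_limsup_sets (T : topologicalType) (C : nat -> set T)
    (x : nat -> T) (k : nat -> nat) (z : T) :
  (forall j, (j <= k j)%N) -> (forall j, C (k j) (x j)) ->
  cluster (x @ \oo) z -> limsup_sets C z.
Proof.
move=> jk Cx clz N _ A zA.
apply: clz zA; exists N => //= j Nj.
by exists (k j) => //=; apply: leq_trans (jk j).
Qed.

(** If the limit split into two closed pieces, disjoint open neighbourhoods [U] and [V] of them
    would, by compactness, cover all late [C k]. Each such connected set lies on the side of [c k],
    eventually the side of [p]; yet points of the other piece are approached by the [C k]. *)
Lemma limsup_sets_connected (R : realType) (T : pseudoMetricType R) (K : set T)
    (C : nat -> set T) (c : nat -> T) (p : T) :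
  compact K -> (forall k, C k `<=` K) -> (forall k, connected (C k)) ->
  (forall k, C k (c k)) -> c @ \oo --> p -> connected (limsup_sets C).
Proof.
move=> cK CK conC Cc cp; apply/connectedP => E [E0 LE sE].
have Lp : limsup_sets C p.
  apply: (@cluster_limsup_sets _ C c id) => // A B cA pB.
  exact: filter_ex (filterI cA (cp _ pB)).
wlog Ep : E E0 LE sE / E false p.
  move=> G; have := Lp; rewrite LE => -[Ep|Ep]; first exact: G Ep.
  apply: (G (E \o negb)) => //=; first by rewrite LE setUC.
  by rewrite separatedC.
have clL : closed (limsup_sets C).
  by apply: closed_bigI => N _; apply: closed_closure.
(* A limit point of one piece stays in the closed union, and separation keeps it out of the other
   piece. *)
have clE b : closed (E b).
  move=> x clx.
  have : limsup_sets C x.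
    apply: clL; apply: closureS clx.
    by rewrite LE; case: b; [exact: subsetUr|exact: subsetUl].
  case: sE => s1 s2; rewrite LE; case: b clx => clx [] // Ex.
    by have : (E false `&` closure (E true)) x by []; rewrite s2.
  by have : (closure (E false) `&` E true) x by []; rewrite s1.
have [U [V [oU oV EU EV UV0]]] :=
  (@normal_openP R T).1 pseudometric_normal _ _ (clE false) (clE true)
    (separated_disjoint sE).
have [N CUV] : exists N, forall k, (N <= k)%N -> C k `<=` U `|` V.
  (* Otherwise arbitrarily late [C k] have points outside both open sets; these cluster at a point
     of the upper limit, which has the open union as a neighbourhood. *)
  apply: contrapT => /forallNP noN.
  have /choice [f Hf] : forall j, exists kx : nat * T,
      [/\ (j <= kx.1)%N, C kx.1 kx.2 & ~ (U `|` V) kx.2].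
    move=> j; have := noN j => /existsNP[k /not_implyP[jk /existsNP[x]]].
    by move=> /not_implyP[Cx nx]; exists (k, x).
  have [z [Kz clz]] : K `&` cluster ((snd \o f) @ \oo) !=set0.
    apply: (cK ((snd \o f) @ \oo)).
    exists 0%N => // j _; have [_ Cx _] := Hf j; exact: CK Cx.
  have Lz : limsup_sets C z.
    by apply: (@cluster_limsup_sets _ C (snd \o f) (fst \o f)) clz => j; have [] := Hf j.
  have UVz : (U `|` V) z.
    by move: Lz; rewrite LE => -[/EU|/EV]; [left|right].
  have [] := clz (~` (U `|` V)) (U `|` V).
  - by exists 0%N => //= j _; have [] := Hf j.
  - by apply: open_nbhs_nbhs; split => //; apply: openU.
  - by move=> y [].
have [M _ cU] : \forall k \near \oo, U (c k).
  by apply: cp; apply: open_nbhs_nbhs; split => //; apply: EU.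
have [y Ey] := E0 true.
have Ly : limsup_sets C y by rewrite LE; right.
have [k [x [Nk Cx Vx]]] := @limsup_setsP _ C y (maxn N M) V Ly
  (open_nbhs_nbhs (conj oV (EV _ Ey))).
rewrite geq_max in Nk; case/andP: Nk => Nk Mk.
have notUV w : U w -> V w -> False.
  by move=> Uw Vw; have : (U `&` V) w by []; rewrite UV0.
have [CU|CV] := connected_subset (open_separated oU oV UV0) (CUV k Nk) (conC k).
  exact: notUV (CU _ Cx) Vx.
exact: notUV (cU k Mk) (CV _ (Cc k)).
Qed.

Lemma mx_cvg (U : Type) (F : set_system U) (S : topologicalType) m n
    (X : U -> 'M[S]_(m, n)) (A : 'M[S]_(m, n)) : Filter F ->
  (forall i j, (fun u => X u i j) @ F --> A i j) -> X @ F --> A.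
Proof.
move=> FF cX B [P AP PB].
have : \forall u \near F, forall ij : 'I_m * 'I_n, P ij.1 ij.2 (X u ij.1 ij.2).
  by apply: filter_forall => -[i j] /=; apply: (cX i j).
by apply: filterS => u Hu; apply: PB => i j; have := Hu (i, j).
Qed.

Lemma mx_box_compact (R : realType) m n (M : R) :
  compact [set A : 'M[R]_(m, n) | forall i j, `|A i j| <= M].
Proof.
pose B := [set v : 'rV[R]_(m * n) | forall k, `[- M, M]%classic (v ord0 k)].
have cB : compact B.
  by apply: (@rV_compact R _ (fun=> `[- M, M]%classic)) => _; exact: segment_compact.
have cv : continuous (@vec_mx R m n).
  move=> v; apply: (@mx_cvg _ (nbhs v)) => i j.
  have vE (u : 'rV[R]_(m * n)) : vec_mx u i j = u ord0 (mxvec_index i j) by rewrite mxE.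
  by under eq_fun do rewrite vE; rewrite vE; exact: coord_continuous.
have -> : [set A : 'M[R]_(m, n) | forall i j, `|A i j| <= M] = vec_mx @` B.
  apply/seteqP; split=> [A AM|_ [v Bv <-] i j].
    exists (mxvec A); last exact: mxvecK.
    by move=> k; case/mxvec_indexP: k => i j; rewrite mxvecE /= in_itv /= -ler_norml.
  by rewrite mxE; have := Bv (mxvec_index i j); rewrite /= in_itv /= -ler_norml.
apply: continuous_compact cB; exact: continuous_subspaceT.
Qed.

(** The estimate is uniform over each [C k], since the points approaching [z] may lie anywhere in
    these sets. *)
Lemma eq_limsup_sets (R : realType) (T : topologicalType) (C : nat -> set T)
    (g : T -> R) (l : R) (z : T) : continuous g ->
  (forall d : R, 0 < d -> exists N, forall k y, (N <= k)%N -> C k y -> `|g y - l| <= d) ->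
  limsup_sets C z -> g z = l.
Proof.
move=> cg gl Lz; apply/eqP; rewrite -subr_eq0 -normr_le0; apply/ler_addgt0Pr => d d0.
have d20 : 0 < d / 2 by rewrite divr_gt0.
have [N HN] := gl _ d20.
have gz : \forall y \near z, `|g z - g y| <= d / 2.
  by move/cvgrPdist_le : (cg z) => /(_ _ d20).
have [k [y [Nk Cy gy]]] := limsup_setsP N Lz gz.
rewrite add0r (splitr d) -(subrKA (g y)).
by apply: (le_trans (ler_normD _ _)); apply: lerD => //; exact: HN Cy.
Qed.

(** * General position *)

(** Near zero the nonzero coefficient of lowest order dominates, whichever of the three it is. *)
Lemma quadratic_near_neq0 (R : realType) (a b c : R) : c != 0 ->
  \forall k \near \oo, a + @harmonic R k * b + @harmonic R k ^+ 2 * c != 0.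
Proof.
move=> c0.
have lim (x y z : R) : x + @harmonic R k * y + @harmonic R k ^+ 2 * z @[k --> \oo] --> x.
  have E : x + 0 * y + 0 * 0 * z = x by ring.
  rewrite -[X in _ --> X]E.
  apply: cvgD; last by apply: cvgM; [apply: cvgM; exact: cvg_harmonic|exact: cvg_cst].
  by apply: cvgD; [exact: cvg_cst|apply: cvgM; [exact: cvg_harmonic|exact: cvg_cst]].
have h0 k : @harmonic R k != 0 by rewrite gt_eqF // harmonic_gt0.
have [a0|a0] := eqVneq a 0; last exact: cvgr_neq0 (lim a b c) a0.
have [b0|b0] := eqVneq b 0.
  by near=> k; rewrite a0 b0 mulr0 !add0r mulf_neq0 // expf_neq0.
have : \forall k \near \oo, b + @harmonic R k * c + @harmonic R k ^+ 2 * 0 != 0.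
  exact: cvgr_neq0 (lim b c 0) b0.
apply: filterS => k; rewrite mulr0 addr0 a0 add0r => h.
by rewrite (_ : _ + _ = harmonic k * (b + harmonic k * c)) ?mulf_neq0 //; ring.
Unshelve. all: by end_near. Qed.

(* No three distinct points of the moment curve (v, v^2, v^3) are collinear. *)
Definition perturb (R : realType) (P : nat -> 'I_3 -> R) (k : nat) : nat -> 'I_3 -> R :=
  fun v i => P v i + harmonic k * v%:R ^+ i.+1.

(** By Lagrange's identity one nonzero coordinate of the cross product suffices, so noncollinearity
    can be checked after projection to the first two coordinates. *)
Lemma gdet_gt0 (R : realType) (u v : 'I_3 -> R) :
  u 0 * v 1 - u 1 * v 0 != 0 -> 0 < gdet u v.
Proof.
move=> h; rewrite -lagrange /dot sum3 !cross_coords -!expr2.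
by rewrite ltr_wpDl ?addr_ge0 ?sqr_ge0 // exprn_even_gt0.
Qed.

(** For each of finitely many triples the projected determinant is quadratic in [harmonic k];
    [seq_sub] supplies the finite index type. *)
Lemma perturb_generic (R : realType) VS (P : nat -> 'I_3 -> R) :
  \forall k \near \oo, generic VS (perturb P k).
Proof.
pose Z := seq_sub VS.
have : \forall k \near \oo, forall s : Z * Z * Z,
    uniq [:: val s.1.1; val s.1.2; val s.2] ->
    0 < gdet (perturb P k (val s.1.2) \- perturb P k (val s.1.1))
             (perturb P k (val s.2) \- perturb P k (val s.1.1)).
  apply: filter_forall => -[[x y] z] /=; move: (val x) (val y) (val z) => {}x {}y {}z.
  have [u|] := boolP (uniq [:: x; y; z]); last first.
    by move=> /negP nu; apply: nearW => k u; case: nu; exact: u.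
  pose X : R := x%:R; pose Y : R := y%:R; pose W : R := z%:R.
  (* The leading coefficient is the Vandermonde determinant of the three labels. *)
  have c0 : (Y - X) * (W - X) * (W - Y) != 0.
    move: u; rewrite /= !inE !negb_or => /andP[/andP[xy xz] /andP[yz _]].
    by rewrite !mulf_neq0 // subr_eq0 eqr_nat eq_sym.
  have := quadratic_near_neq0
    ((P y 0 - P x 0) * (P z 1 - P x 1) - (P y 1 - P x 1) * (P z 0 - P x 0))
    ((Y - X) * (P z 1 - P x 1) + (P y 0 - P x 0) * (W ^+ 2 - X ^+ 2)
     - (Y ^+ 2 - X ^+ 2) * (P z 0 - P x 0) - (P y 1 - P x 1) * (W - X)) c0.
  apply: filterS => k h _; apply: gdet_gt0.
  by move: h; congr (_ != _); rewrite /perturb /= -/X -/Y -/W !expr1; ring.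
apply: filterS => k Hk x y z xV yV zV.
exact: (Hk (SeqSub xV, SeqSub yV, SeqSub zV)).
Qed.

(** * Configurations as placements of the tree vertices *)

Lemma sqdist_continuous (R : realType) n (x y : 'I_n) :
  continuous (fun p : 'M[R]_(n, 3) => sqdist p x y).
Proof.
have cc (i : 'I_3) : continuous (fun p : 'M[R]_(n, 3) => (p x i - p y i) ^+ 2).
  by apply: contX; apply: contB; exact: coord_continuous.
rewrite (_ : (fun p => _) = fun p : 'M[R]_(n, 3) =>
  (p x 0 - p y 0) ^+ 2 + (p x 1 - p y 1) ^+ 2 + (p x 2 - p y 2) ^+ 2).
  by apply: contD => //; exact: contD.
by apply/funext => p; rewrite /sqdist sum3.
Qed.

(** Tree vertices outside the image of [f] start at the origin; [perturb] separates them
    afterwards. *)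
Definition extend (R : realType) n (f : 'I_n -> nat) (p : 'M[R]_(n, 3)) :
    nat -> 'I_3 -> R :=
  fun v i => if [pick x | f x == v] is Some x then p x i else 0.

Lemma extendE (R : realType) n (f : 'I_n -> nat) (p : 'M[R]_(n, 3)) x :
  injective f -> extend f p (f x) = p x.
Proof.
move=> fI; apply/funext => i; rewrite /extend; case: pickP => [y /eqP /fI -> //|].
by move=> /(_ x); rewrite eqxx.
Qed.

Definition restrict (R : realType) n (f : 'I_n -> nat) (P : nat -> 'I_3 -> R) :
    'M[R]_(n, 3) := \matrix_(x, i) P (f x) i.

Lemma sqdist_restrict (R : realType) n (f : 'I_n -> nat) (P : nat -> 'I_3 -> R) x y :
  sqdist (restrict f P) x y = sqd (P (f x)) (P (f y)).
Proof. by rewrite /sqdist /sqd; apply: eq_bigr => i _; rewrite !mxE. Qed.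

Lemma perturb_cvg (R : realType) n (f : 'I_n -> nat) (p : 'M[R]_(n, 3)) :
  injective f -> restrict f (perturb (extend f p) k) @[k --> \oo] --> p.
Proof.
move=> fI; apply: (@mx_cvg _ (nbhs \oo)) => x i.
have E : p x i + 0 * (f x)%:R ^+ i.+1 = p x i by ring.
have H : p x i + @harmonic R k * (f x)%:R ^+ i.+1 @[k --> \oo] --> p x i.
  rewrite -[X in _ --> X]E; apply: cvgD; first exact: cvg_cst.
  by apply: cvgM; [exact: cvg_harmonic|exact: cvg_cst].
by apply: cvg_trans H; apply: near_eq_cvg; apply: nearW => k;
  rewrite mxE /perturb extendE.
Qed.

Lemma sum_bound (R : realType) (VS : seq nat) (G : nat -> 'I_3 -> R) v i :
  (forall v i, 0 <= G v i) -> v \in VS -> G v i <= \sum_(u <- VS) \sum_j G u j.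
Proof.
move=> G0 vV; rewrite (big_rem v) //= (bigD1 i) //= -addrA lerDl addr_ge0 //.
  by apply: sumr_ge0.
by apply: sumr_ge0 => u _; apply: sumr_ge0.
Qed.

Lemma harmonic_le1 (R : realType) k : @harmonic R k <= 1.
Proof. by rewrite /harmonic /= invf_le1 // ler1n. Qed.

(** Three coordinate differences, each at most [2 * S]. *)
Lemma sqd_le (R : realType) (u v : 'I_3 -> R) (S : R) :
  (forall i, `|u i| <= S) -> (forall i, `|v i| <= S) -> sqd u v <= 12 * S ^+ 2.
Proof.
move=> uS vS; have b i : (u i - v i) ^+ 2 <= (2 * S) ^+ 2.
  rewrite -(real_normK (num_real _)).
  rewrite ler_sqr ?nnegrE //; last by rewrite mulr_ge0 // (le_trans _ (uS 0)).
  by apply: (le_trans (ler_normB _ _)); rewrite mulr2n mulrDl mul1r lerD.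
by rewrite /sqd sum3; have := b 0; have := b 1; have := b 2; lra.
Qed.

Lemma coord_le (R : realType) (u v : 'I_3 -> R) (B : R) i :
  0 <= B -> sqd u v <= B ^+ 2 -> `|u i - v i| <= B.
Proof.
move=> B0 uvB; rewrite -ler_sqr ?nnegrE // real_normK ?num_real //.
apply: le_trans uvB; rewrite /sqd (bigD1 i) //= lerDl sumr_ge0 // => j _.
exact: sqr_ge0.
Qed.

(** The component of [p] may miss [q] itself, so the point reached is only asked to share the tree
    lengths of [q]. *)
Lemma tree3_component (R : realType) n VS E (f : 'I_n -> nat) (e : rel 'I_n)
    (l : 'I_n -> 'I_n -> R) (p q : 'M[R]_(n, 3)) :
  tree3 VS E -> injective f -> (forall x, f x \in VS) ->
  (forall x y, e x y -> E (f x) (f y)) ->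
  realizations e l p -> realizations e l q ->
  exists2 q', connected_component (realizations e l) p q' &
    forall x y, E (f x) (f y) -> sqdist q' x y = sqdist q x y.
Proof.
move=> tE fI fV eE rp rq.
(* a weight defined on all of R, which avoids paths over a subspace *)
pose w (t : R) := sin t ^+ 2.
have cw : continuous w by apply: contX; exact: continuous_sin.
have w01 t : 0 <= w t <= 1.
  by rewrite /w sqr_ge0 /= -(cos2Dsin2 t) lerDr sqr_ge0.
have w0 : w 0 = 0 by rewrite /w sin0 expr0n.
have w1 : w (pi / 2) = 1 by rewrite /w sin_pihalf expr1n.
have [N _ HN] : \forall k \near \oo, generic VS (perturb (extend f p) k) /\
    generic VS (perturb (extend f q) k).
  by apply: filterI; exact: perturb_generic.
(* Shifting the index by [N] makes every member of both sequences generic. *)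
pose P k := perturb (extend f p) (k + N); pose Q k := perturb (extend f q) (k + N).
have cP : restrict f (P k) @[k --> \oo] --> p.
  exact: (cvg_comp (fun k => (k + N)%N) (fun k => restrict f (perturb (extend f p) k))
    (cvg_addnr N) (@perturb_cvg R n f p fI)).
have cQ : restrict f (Q k) @[k --> \oo] --> q.
  exact: (cvg_comp (fun k => (k + N)%N) (fun k => restrict f (perturb (extend f q) k))
    (cvg_addnr N) (@perturb_cvg R n f q fI)).
have /choice[X HX] : forall k, exists X, lifts w 0 E (P k) (Q k) X /\
    exists2 r, r \in VS & forall t, X r t = P k r.
  move=> k; have [gP gQ] := HN _ (leq_addl k N).
  by have [X ? ?] := tree3_lift cw w01 w0 tE gP gQ; exists X.
pose M k t := restrict f (fun v => X k v t).
pose C k := range (M k).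
have cM k : continuous (M k).
  move=> t; apply: (@mx_cvg _ (nbhs t)) => x i.
  have ME s : M k s x i = X k (f x) s i by rewrite mxE.
  rewrite ME (_ : (fun s => _) = (X k (f x))^~ i); last exact/funext.
  by have [[cX _ _] _] := HX k; exact: cX.
have conC k : connected (C k).
  apply: connected_continuous_connected; last exact: continuous_subspaceT.
  exact/connected_intervalP.
(* As [harmonic k <= 1], [G] dominates the coordinates of both perturbed placements for all [k]; its
   total [S] bounds them uniformly on the tree. *)
pose G v i := `|extend f p v i| + `|extend f q v i| + v%:R ^+ i.+1 : R.
have G0 v i : 0 <= G v i by rewrite !addr_ge0 // exprn_ge0.
pose S := \sum_(v <- VS) \sum_i G v i.
have pert_le (Z : nat -> 'I_3 -> R) k v i : `|Z v i| + v%:R ^+ i.+1 <= G v i -> v \in VS ->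
    `|perturb Z k v i| <= S.
  move=> ZG vV; apply: le_trans (sum_bound i G0 vV); apply: le_trans ZG.
  apply: (le_trans (ler_normD _ _)); rewrite lerD2l normrM.
  rewrite (ger0_norm (harmonic_ge0 _)) normrX normr_nat.
  by rewrite ler_piMl ?exprn_ge0 // harmonic_le1.
have PS k v i : v \in VS -> `|P k v i| <= S.
  by apply: pert_le; rewrite /G lerD2r lerDl.
have QS k v i : v \in VS -> `|Q k v i| <= S.
  by apply: pert_le; rewrite /G lerD2r lerDr.
have S0 : 0 <= S by rewrite sumr_ge0 // => v _; rewrite sumr_ge0.
(* A squared edge length is at most [12 * S^2 + 12 * S^2], hence at most [(5 * S)^2]. *)
have edgeS k x y t i : E x y -> `|X k x t i - X k y t i| <= 5 * S.
  move=> xy; have [[_ _ fX] _] := HX k; have [_ xV yV] := tree3_edge tE xy.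
  apply: coord_le; first by rewrite mulr_ge0.
  rewrite fX //; apply: (le_trans (mix_le (w01 t) _ _)).
  - by rewrite sqd_dot dot_ge0.
  - by rewrite sqd_dot dot_ge0.
  - have := sqd_le (fun i => PS k x i xV) (fun i => PS k y i yV).
    have := sqd_le (fun i => QS k x i xV) (fun i => QS k y i yV).
    by have := sqr_ge0 S; lra.
(* The motionless vertex contributes [S], the chain of edges leading to it the rest. *)
pose K := [set A : 'M[R]_(n, 3) | forall i j, `|A i j| <= (size VS)%:R * (5 * S) + S].
have CK k : C k `<=` K.
  move=> _ [t _ <-] x i; rewrite mxE.
  have [_ [r rV Xr]] := HX k.
  have := @tree3_diam R _ _ _ (fun v => X k v t i) tE
    (fun x y => @edgeS k x y t i) _ _ (fV x) rV.
  rewrite Xr => h; rewrite -[X in `|X|](subrK (P k r i)).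
  by apply: (le_trans (ler_normD _ _)); rewrite lerD // PS.
have M0 k : M k 0 = restrict f (P k).
  apply/matrixP => x i; rewrite !mxE; have [[_ X0 _] _] := HX k.
  exact: X0.
have cM0 : M k 0 @[k --> \oo] --> p by under eq_fun do rewrite M0.
have MC k t : C k (M k t) by exists t.
have cK : compact K by exact: mx_box_compact.
pose L := limsup_sets C.
have conL : connected L.
  exact: (limsup_sets_connected cK CK conC (fun k => MC k 0) cM0).
have Lp : L p.
  apply: (@cluster_limsup_sets _ C (M^~ 0) id) => // A B cA pB.
  exact: filter_ex (filterI cA (cM0 _ pB)).
have MD k t x y : E (f x) (f y) -> sqdist (M k t) x y =
    mix (w t) (sqdist (restrict f (P k)) x y) (sqdist (restrict f (Q k)) x y).
  by move=> xy; rewrite !sqdist_restrict; have [[_ _ fX] _] := HX k; exact: fX.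
have cvD (Z : nat -> 'M[R]_(n, 3)) z x y : Z k @[k --> \oo] --> z ->
    sqdist (Z k) x y @[k --> \oo] --> sqdist z x y.
  move=> cZ; exact: (cvg_comp Z (fun A => sqdist A x y) cZ (@sqdist_continuous R n x y z)).
have LR : L `<=` realizations e l.
  move=> z Lz x y xy; apply: (eq_limsup_sets (@sqdist_continuous R n x y) _ Lz) => d d0.
  have /cvgrPdist_le/(_ _ d0) hP := cvD _ _ x y cP.
  have /cvgrPdist_le/(_ _ d0) hQ := cvD _ _ x y cQ.
  have [m _ Hm] := filterI hP hQ.
  exists m => k _ mk [t _ <-]; have [] := Hm _ mk.
  (* Since [p] and [q] share the length [l x y], the error along the path is the mixture of the
     errors of the two perturbed configurations, at most [d] for every [t]. *)
  rewrite (rp _ _ xy) (rq _ _ xy) (MD _ _ _ _ (eE _ _ xy)) => h1 h2.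
  rewrite distrC (_ : _ - _ = mix (w t) (l x y - sqdist (restrict f (P k)) x y)
    (l x y - sqdist (restrict f (Q k)) x y)); last by rewrite /mix; ring.
  have /andP[] := w01 t; move: (w t) => s s0 s1.
  apply: (le_trans (ler_normD _ _)); rewrite !normrM (ger0_norm s0).
  rewrite (@ger0_norm _ (1 - s)) ?subr_ge0 //.
  have -> : d = (1 - s) * d + s * d by ring.
  by rewrite lerD // ler_wpM2l // subr_ge0.
(* A cluster point of the path positions at [pi / 2], where the weight is 1. *)
have [q' [_ clq']] : K `&` cluster (M k (pi / 2) @[k --> \oo]) !=set0.
  apply: (cK (M k (pi / 2) @[k --> \oo])).
  by exists 0%N => // k _; exact: CK (MC k _).
exists q'.
  exists L; first by split.
  by apply: (@cluster_limsup_sets _ C (M^~ (pi / 2)) id).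
move=> x y xy.
(* Restricting to these end positions alone gives sets whose tree lengths are exactly those of the
   perturbed [q]. *)
have Lq' : limsup_sets (fun k => [set M k (pi / 2)]) q'.
  by apply: (@cluster_limsup_sets _ _ (M^~ (pi / 2)) id).
apply: (eq_limsup_sets (@sqdist_continuous R n x y) _ Lq') => d d0.
have /cvgrPdist_le/(_ _ d0)[m _ Hm] := cvD _ _ x y cQ.
exists m => k _ mk ->; rewrite MD // w1 distrC.
by have := Hm _ mk; rewrite /mix subrr mul0r add0r mul1r.
Qed.

Theorem mainTheorem5 (R : realType) (n : nat) (e : rel 'I_n)
  (F : seq ('I_n * 'I_n)) :
  simple_graph e -> nonedge_set e F -> partial_3tree (graph_union e F) ->
  covering_map_property3 R e F.
Proof.
move=> _ _ [VS [E [f [tE fI fV HE]]]] l _ p rp; apply/seteqP; split.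
  by move=> _ [q cq <-]; exists q => //; exact: connected_component_sub cq.
move=> _ [q rq <-].
have eE x y : e x y -> E (f x) (f y) by move=> xy; apply: HE; rewrite /graph_union xy.
have [q' cq' qq'] := tree3_component tE fI fV eE rp rq.
(* Pairs of [F] are mapped to edges of the 3-tree, so their lengths agree at [q'] and [q]. *)
exists q' => //; apply/eq_in_map => -[x y] xyF /=.
by apply: qq'; apply: HE; rewrite /graph_union xyF orbT.
Qed.
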